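(* For $y^\star(x)=\arg\min_{y\in\mathbb R}\Upsilon_\epsilon(x,y)$, we have $$|y^\star(x)-y^\star(x')|\le\frac1G\|\ell(x)-\ell(x')\|_\infty\qquad\text{for all }x,x'\in\mathcal X,$$ where $\ell(x)=(\ell_1(x),\dots,\ell_N(x))$. Moreover, if each $\ell_i$ is $G$-Lipschitz, we have $|y^\star(x)-y^\star(x')|\le\|x-x'\|$ for all $x,x'\in\mathcal X$.
   Context: $\mathcal X\subset\mathbb R^d$, $\|\cdot\|$ is the Euclidean norm, $\ell_1,\dots,\ell_N:\mathcal X\to\mathbb R$ are loss functions, $\psi:\mathbb R_+\to\mathbb R$ is an arbitrary convex function, $G>0$ and $\epsilon>0$. Let $\epsilon'=\epsilon/(2\log N)$ and $\psi_\epsilon(q)=\psi(q)+\epsilon' q\log q$, and let $\psi_\epsilon^*(v)=\max_{t\in\mathrm{dom}(\psi_\epsilon)}\{vt-\psi_\epsilon(t)\}$ be its Fenchel conjugate. Then $\Upsilon_\epsilon(x,y)=\sum_{i\in[N]}\psi_\epsilon^*(\ell_i(x)-Gy)+Gy$ for $x\in\mathcal X$, $y\in\mathbb R$.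
   Formalization: The minimizer of Υ_ε(x,·) need not be unique for arbitrary convex ψ (e.g. ψ(q)=|q−1/N|, all ℓ_i equal), and the bound fails for arbitrary choices; y*(x) is taken to be the least minimizer (proved to exist), and N ≥ 2 is assumed so that ε' is defined. *)

(* Defs.v *)
From mathcomp Require Export all_boot all_order all_algebra.
From mathcomp Require Export all_classical all_reals all_analysis.
Export Order.TTheory GRing.Theory Num.Theory.
Export numFieldNormedType.Exports.
Set Implicit Arguments.
Unset Strict Implicit.
Unset Printing Implicit Defensive.
Local Open Scope classical_set_scope.
Local Open Scope ring_scope.

(* The library norm on row vectors is the max norm, hence this definition. *)
Definition enorm (R : realType) (d : nat) (x : 'rV[R]_d) : R :=
  Num.sqrt (\sum_(i < d) x 0 i ^+ 2).

Definition eps' (R : realType) (N : nat) (eps : R) : R :=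
  eps / (2 * ln (N%:R : R)).

(* Meaningful on the domain [0, +oo[, with 0 log 0 = 0. *)
Definition psi_eps (R : realType) (N : nat) (eps : R) (psi : R -> R) (q : R) : R :=
  psi q + eps' N eps * (q * ln q).

(* For psi convex on [0, +oo[, 1 < N and 0 < eps, psi_eps is superlinear with
   slope -oo at 0, so this real supremum is finite and is a maximum. *)
Definition psi_conj (R : realType) (N : nat) (eps : R) (psi : R -> R) (v : R) : R :=
  sup [set v * t - psi_eps N eps psi t | t in `[0, +oo[%classic].

Definition Upsilon (R : realType) (d N : nat) (eps G : R) (psi : R -> R)
    (l : 'I_N -> 'rV[R]_d -> R) (x : 'rV[R]_d) (y : R) : R :=
  (\sum_(i < N) psi_conj N eps psi (l i x - G * y)) + G * y.

Definition argmin (R : realType) (f : R -> R) : set R :=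
  [set y | forall z, f y <= f z].

(* When psi has kinks, the minimizers of Upsilon x may form a nondegenerate
   compact interval (e.g. psi q = `|q - N^-1| and l i x independent of i), and
   then no bound can hold for arbitrary selections of minimizers. Ties are
   broken by taking the least minimizer. *)
Definition ystar (R : realType) (d N : nat) (eps G : R) (psi : R -> R)
    (l : 'I_N -> 'rV[R]_d -> R) (x : 'rV[R]_d) : R :=
  inf (argmin (Upsilon eps G psi l x)).

Lemma ystar_unique (R : realType) (d N : nat) (eps G : R) (psi : R -> R)
    (l : 'I_N -> 'rV[R]_d -> R) (x : 'rV[R]_d) (y : R) :
  argmin (Upsilon eps G psi l x) = [set y] -> ystar eps G psi l x = y.
Proof. by rewrite /ystar => ->; rewrite inf1. Qed.

Definition lvec (R : realType) (d N : nat) (l : 'I_N -> 'rV[R]_d -> R)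
    (x : 'rV[R]_d) : 'rV[R]_N := \row_i l i x.

(* Main.v *)
Require Import Defs.
From mathcomp Require Import ring lra.
Set Implicit Arguments.
Unset Strict Implicit.
Unset Printing Implicit Defensive.
Local Open Scope classical_set_scope.
Local Open Scope ring_scope.

(* The conjugate f of psi_eps is finite (psi is bounded below by an affine
   function and q log q is superlinear) and convex.  Convexity of f says that
   f (u - G y) has decreasing differences in (u, y), so the least minimizer of
   y |-> \sum_i f (u i - G y) + G y is nondecreasing in u; since adding a
   constant c to all the u i shifts it by c / G, it is 1/G-Lipschitz for the
   max norm. *)

(** * Inequalities and continuity for convex functions of one real variable *)

Section convex_real_functions.
Context {R : realType}.
Implicit Types (D : set R) (f : R -> R).

(** Unnormalised weights, and [z] given by an equation instead of a quotient, keep later convexity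
    steps free of division. *)
Lemma convex_function_weighted D f (a b x y z : R) :
  convex_function (E := R^o) D f -> D x -> D y -> 0 <= a -> 0 <= b ->
  0 < a + b -> (a + b) * z = a * x + b * y ->
  (a + b) * f z <= a * f x + b * f y.
Proof.
move=> cf Dx Dy a0 b0 ab0 zE.
have abn : a + b != 0 by rewrite gt_eqF.
have p0 : 0 <= a / (a + b) by rewrite divr_ge0// ltW.
have p1 : a / (a + b) <= 1 by rewrite ler_pdivrMr// mul1r lerDl.
have : f (a / (a + b) * x + (1 - a / (a + b)) * y) <=
    a / (a + b) * f x + (1 - a / (a + b)) * f y.
  by apply: (cf (Itv01 p0 p1) x y); rewrite inE.
have -> : a / (a + b) * x + (1 - a / (a + b)) * y = z.
  by apply: (mulfI abn); rewrite zE; field.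
rewrite -(ler_pM2l ab0) => /le_trans; apply.
by rewrite le_eqVlt; apply/orP; left; apply/eqP; field.
Qed.

(** Both [a + h] and [b] lie between [a] and [b + h], with the weights [b - a] and [h] swapped; the
    two convexity inequalities add up to the claim times [b - a + h]. *)
Lemma convex_function_incr_diff f (a b h : R) :
  convex_function (E := R^o) setT f -> a <= b -> 0 <= h ->
  f (a + h) - f a <= f (b + h) - f b.
Proof.
move=> cf ab h0.
have [hab|hab] := leP (b - a + h) 0.
  have -> : h = 0 by lra.
  by rewrite !addr0 !subrr.
have H1 : (b - a + h) * f (a + h) <= (b - a) * f a + h * f (b + h).
  apply: convex_function_weighted cf _ _ _ _ _ _ => //; [lra|ring].
have H2 : (h + (b - a)) * f b <= h * f a + (b - a) * f (b + h).
  apply: convex_function_weighted cf _ _ _ _ _ _ => //; [lra|lra|ring].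
rewrite -(ler_pM2l hab); lra.
Qed.

(** For the upper bound, [x + h * e] lies between [x] and [x + e]; for the lower bound, [x] lies
    between [x - e] and [x + h * e]. *)
Lemma convex_function_local_lipschitz f (x e h : R) :
  convex_function (E := R^o) setT f -> 0 <= h <= 1 ->
  `|f (x + h * e) - f x| <= h * (`|f (x + e) - f x| + `|f (x - e) - f x|).
Proof.
move=> cf /andP[h0 h1].
have H1 : (h + (1 - h)) * f (x + h * e) <= h * f (x + e) + (1 - h) * f x.
  apply: convex_function_weighted cf _ _ _ _ _ _ => //; [lra|lra|ring].
have H2 : (1 + h) * f x <= 1 * f (x + h * e) + h * f (x - e).
  apply: convex_function_weighted cf _ _ _ _ _ _ => //; [lra|ring].
have A1 : h * (f (x + e) - f x) <= h * `|f (x + e) - f x|.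
  by rewrite ler_wpM2l// ler_norm.
have A2 : h * (f (x - e) - f x) <= h * `|f (x - e) - f x|.
  by rewrite ler_wpM2l// ler_norm.
have B1 : 0 <= h * `|f (x + e) - f x| by rewrite mulr_ge0.
have B2 : 0 <= h * `|f (x - e) - f x| by rewrite mulr_ge0.
rewrite ler_norml; apply/andP; split; lra.
Qed.

Lemma convex_function_continuous f :
  convex_function (E := R^o) setT f -> continuous f.
Proof.
move=> cf x; apply/cvgrPdist_lt => e e0.
(* The final 1 makes [C] positive; the other terms are symmetric in the directions [1] and [-1], so
   one constant serves both sides of [x]. *)
pose C := `|f (x + 1) - f x| + `|f (x - 1) - f x| + 1.
have C0 : 0 < C by rewrite ltr_wpDl// addr_ge0.
pose del := Num.min 1 (e / C).
have del0 : 0 < del by rewrite lt_min ltr01 divr_gt0.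
apply/nbhs_normP; exists del => //= z /= xz.
move: xz; rewrite /ball_/= lt_min => /andP[xz1 xzC].
have B (s : R) : (s = 1 \/ s = -1) -> z = x + `|x - z| * s ->
    `|f x - f z| <= `|x - z| * (C - 1).
  move=> s1 zE; have h01 : 0 <= `|x - z| <= 1 by rewrite normr_ge0 ltW.
  have := convex_function_local_lipschitz x s cf h01.
  rewrite -zE distrC /C addrK.
  by case: s1 => ->; rewrite ?opprK // [X in _ * X]addrC.
have {}B : `|f x - f z| <= `|x - z| * (C - 1).
  have [xz|xz] := leP x z.
    apply: (B 1); first by left.
    by rewrite ler0_norm; lra.
  apply: (B (-1)); first by right.
  by rewrite gtr0_norm; lra.
apply: le_lt_trans B _; apply: (@le_lt_trans _ _ (`|x - z| * C)).
  by rewrite ler_wpM2l//; lra.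
by rewrite -ltr_pdivlMr.
Qed.

(** The chord over [1, 2] extended to the left, and the chord over [0, 1] extended to the right, lie
    below the graph; absolute values merge the two bounds into one line. *)
Lemma convex_function_affine_minorant f :
  convex_function (E := R^o) `[0, +oo[%classic f ->
  exists A B : R, forall t, 0 <= t -> A + B * t <= f t.
Proof.
move=> cf.
exists (f 1 - `|f 2 - f 1|), (- `|f 1 - f 0|) => t t0.
have N2 := normr_ge0 (f 2 - f 1); have N1 := normr_ge0 (f 1 - f 0).
have D (s : R) : 0 <= s -> `[0, +oo[%classic s.
  by move=> s0; rewrite /= in_itv/= s0.
have [t1|t1] := leP t 1.
- have : (1 + (1 - t)) * f 1 <= 1 * f t + (1 - t) * f 2.
    apply: convex_function_weighted cf _ _ _ _ _ _; try lra; try (apply: D; lra); ring.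
  have : (1 - t) * (f 2 - f 1) <= (1 - t) * `|f 2 - f 1|.
    by rewrite ler_wpM2l ?ler_norm//; lra.
  have := mulr_ge0 t0 N1; have := mulr_ge0 t0 N2; lra.
- have : (1 + (t - 1)) * f 1 <= 1 * f t + (t - 1) * f 0.
    apply: convex_function_weighted cf _ _ _ _ _ _; try lra; try (apply: D; lra); ring.
  have : (t - 1) * (f 0 - f 1) <= (t - 1) * `|f 1 - f 0|.
    rewrite ler_wpM2l//; first by lra.
    by rewrite distrC ler_norm.
  lra.
Qed.

(** The tangent bound [1 + s <= expR s] at [s = w - ln t], multiplied by [t], with the summand [t]
    dropped. *)
Lemma mulr_ln_young (w t : R) : 0 <= t -> w * t - t * ln t <= expR w.
Proof.
rewrite le_eqVlt => /predU1P[<-|t0].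
  by rewrite mulr0 mul0r subr0 expR_ge0.
have := expR_ge1Dx (w - ln t).
rewrite expRB lnK ?posrE// ler_pdivlMr//; lra.
Qed.

End convex_real_functions.

(** * Least minimizer of a continuous coercive function *)

Section least_minimizer.
Context {R : realType}.
Implicit Types F : R -> R.

Lemma argmin_le_image F (y z : R) : argmin F y -> F z <= F y -> argmin F z.
Proof. by move=> Fy zy w; apply: le_trans zy (Fy w). Qed.

(** Coercivity confines the minimizers to a segment, on which the minimum is attained; they form a
    nonempty compact set, whose least element is its infimum. *)
Lemma argmin_inf F (C k : R) : continuous F -> 0 < k ->
    (forall y, C + k * `|y| <= F y) ->
  argmin F (inf (argmin F)) /\ forall y, argmin F y -> inf (argmin F) <= y.
Proof.
move=> cF k0 coer.
(* Outside the radius [M] the coercive lower bound already exceeds [F 0]. *)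
pose M := `|(F 0 - C) / k|.
have far y : M < `|y| -> F 0 < F y.
  move=> My; apply: lt_le_trans (coer y).
  rewrite -ltrBlDl mulrC -ltr_pdivrMr//.
  exact: le_lt_trans (ler_norm _) My.
have M0 : 0 <= M by exact: normr_ge0.
have [c _ cmin] : exists2 c, c \in `[- M, M] &
    forall t, t \in `[- M, M] -> F c <= F t.
  apply: EVT_min; first by lra.
  exact: continuous_subspaceT.
have Fc : argmin F c.
  move=> z; have [zM|/far/ltW] := leP `|z| M.
    by apply: cmin; rewrite in_itv/= -ler_norml.
  by apply: le_trans; apply: cmin; rewrite in_itv/=; lra.
have bnd y : argmin F y -> `|y| <= M.
  by move=> /(_ 0); rewrite leNgt => Fy; rewrite leNgt; apply: contra Fy => /far.
(* The minimizers are the sublevel set of [F] at its minimum value [F c]. *)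
have clF : closed (argmin F).
  have -> : argmin F = F @^-1` [set r | r <= F c].
    by apply/seteqP; split => y /= => [/(_ c)//|]; exact: argmin_le_image.
  by apply: preimage_closed; [move=> y _; exact: cF|exact: closed_le].
have cpt : compact (argmin F).
  apply: (subclosed_compact clF (@segment_compact _ (- M) M)) => y /bnd yM /=.
  by rewrite in_itv/= -ler_norml.
have [m + mmin] := @compact_EVT_min _ _ id _ (ex_intro _ c Fc) cpt
  (continuous_subspaceT (fun=> cvg_id)).
rewrite inE => Fm.
have lbF : lbound (argmin F) m by move=> y Fy; apply: mmin; rewrite inE.
suff -> : inf (argmin F) = m by [].
apply/eqP; rewrite eq_le; apply/andP; split.
  by apply: ge_inf => //; exists m.
by apply: lb_le_inf => //; exists c.
Qed.

End least_minimizer.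

(** * Finiteness and convexity of the conjugate *)

Section conjugate.
Context {R : realType} (N : nat) (eps : R) (psi : R -> R).
Hypotheses (N_gt1 : (1 < N)%N) (eps_gt0 : 0 < eps).
Hypothesis psi_convex : convex_function (E := R^o) `[0, +oo[%classic psi.

Lemma eps'_gt0 : 0 < eps' N eps.
Proof. by rewrite divr_gt0// mulr_gt0// ln_gt0// ltr1n. Qed.

(** Ensures that [sup] in [psi_conj] is a true supremum and not a default value. *)
Lemma psi_conj_has_ubound (v : R) :
  has_ubound [set v * t - psi_eps N eps psi t | t in `[0, +oo[%classic].
Proof.
have [A [B AB]] := convex_function_affine_minorant psi_convex.
have e0 := eps'_gt0; set e := eps' N eps in e0 *.
(* The slope [B] of the affine minorant is absorbed into [v]; what remains is [e] times the Young
   bound at [(v - B) / e]. *)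
exists (e * expR ((v - B) / e) - A) => _ [t /= + <-].
rewrite in_itv/= andbT => t0; rewrite /psi_eps -/e.
have := mulr_ln_young ((v - B) / e) t0.
rewrite -(ler_pM2l e0).
rewrite [X in X <= _ -> _](_ : _ = (v - B) * t - e * (t * ln t)).
  by have := AB _ t0; lra.
by field; rewrite gt_eqF.
Qed.

Lemma psi_conj_ge (v t : R) : 0 <= t ->
  v * t - psi_eps N eps psi t <= psi_conj N eps psi v.
Proof.
move=> t0; apply: ub_le_sup; first exact: psi_conj_has_ubound.
by exists t => //=; rewrite in_itv/= t0.
Qed.

(** A supremum over [t] of functions affine in [v]. *)
Lemma psi_conj_convex : convex_function (E := R^o) setT (psi_conj N eps psi).
Proof.
move=> p x y _ _; set q : R := p%:num.
change (psi_conj N eps psi (q * x + (1 - q) * y) <=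
  q * psi_conj N eps psi x + (1 - q) * psi_conj N eps psi y).
apply: ge_sup.
  by apply: image_nonempty; exists 0; rewrite /= in_itv/= lexx.
move=> _ [t /= + <-]; rewrite in_itv/= andbT => t0.
have q0 : 0 <= q by rewrite /q ge0.
have q1 : 0 <= 1 - q by rewrite subr_ge0 /q le1.
have := lerD (ler_wpM2l q0 (psi_conj_ge x t0)) (ler_wpM2l q1 (psi_conj_ge y t0)).
by apply: le_trans; lra.
Qed.

End conjugate.

(** * Minimizers of [Upsilon] and their dependence on the losses *)

Section Upsilon.
Context {R : realType} (d N : nat) (l : 'I_N -> 'rV[R]_d -> R) (psi : R -> R).
Context (G eps : R).
Hypotheses (N_gt1 : (1 < N)%N) (G_gt0 : 0 < G) (eps_gt0 : 0 < eps).
Hypothesis psi_convex : convex_function (E := R^o) `[0, +oo[%classic psi.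

Local Notation U := (Upsilon eps G psi l).
Local Notation f := (psi_conj N eps psi).

Lemma Upsilon_continuous (x : 'rV[R]_d) : continuous (U x).
Proof.
have cf := convex_function_continuous (psi_conj_convex N_gt1 eps_gt0 psi_convex).
have cG : continuous (fun y : R => G * y) by exact: mulrl_continuous.
move=> y; apply: cvgD; last exact: cG.
apply: cvg_big => [|i _]; first exact: add_continuous.
apply: (@continuous_comp _ _ _ (fun y => l i x - G * y) f); last exact: cf.
by apply: cvgB; [exact: cvg_cst|exact: cG].
Qed.

(* The trial points t = 1 (for y <= 0) and t = 0 (for y >= 0) in the supremum
   defining the conjugate; the former needs 1 < N. *)
Lemma Upsilon_coercive (x : 'rV[R]_d) :
  exists C : R, forall y, C + G * `|y| <= U x y.
Proof.
pose g := psi_eps N eps psi.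
pose C1 := \sum_(i < N) (l i x - g 1).
pose C0 := \sum_(i < N) (- g 0).
exists (- `|C1| - `|C0|) => y.
have S t : 0 <= t ->
    \sum_(i < N) ((l i x - G * y) * t - g t) + G * y <= U x y.
  move=> t0; rewrite lerD2r; apply: ler_sum => i _; exact: psi_conj_ge.
have Cn1 := ler_norm (- C1); have Cn0 := ler_norm (- C0).
rewrite !normrN in Cn1 Cn0.
have := normr_ge0 C1; have := normr_ge0 C0 => C0n C1n.
have [y0|y0] := leP 0 y.
  apply: le_trans (S 0 (lexx _)).
  rewrite (eq_bigr (fun=> - g 0)) => [|i _]; last by rewrite mulr0 sub0r.
  by rewrite (ger0_norm y0) -/C0; lra.
apply: le_trans (S 1 ler01).
rewrite (eq_bigr (fun i => (l i x - g 1) + (- (G * y)))) => [|i _]; last by ring.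
rewrite big_split/= sumr_const card_ord -/C1 (ltr0_norm y0).
have : - (G * y) *+ 2 <= - (G * y) *+ N.
  by apply: ler_wpMn2l => //; rewrite oppr_ge0 mulr_ge0_le0 ?ltW.
rewrite mulr2n; lra.
Qed.

Lemma ystar_argmin (x : 'rV[R]_d) : argmin (U x) (ystar eps G psi l x) /\
  forall y, argmin (U x) y -> ystar eps G psi l x <= y.
Proof.
have [C HC] := Upsilon_coercive x.
exact: argmin_inf (@Upsilon_continuous x) G_gt0 HC.
Qed.

(** Otherwise [m' + c < m], and increasing differences carry the optimality of [m'] for [x'] over to
    [m' + c] for [x], against the choice of [m] as least minimizer. *)
Lemma ystar_le_shift (x x' : 'rV[R]_d) (c : R) :
  (forall i, l i x <= l i x' + G * c) ->
  ystar eps G psi l x <= ystar eps G psi l x' + c.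
Proof.
move=> lc; have [xm xmin] := ystar_argmin x; have [x'm _] := ystar_argmin x'.
set m := ystar _ _ _ _ x in xm xmin *.
set m' := ystar _ _ _ _ x' in x'm *.
rewrite leNgt; apply/negP => ltm.
suff /xmin : argmin (U x) (m' + c) by rewrite leNgt ltm.
apply: argmin_le_image xm _.
(* Testing [m'] against [m - c] gives the same gap [m - (m' + c)] as testing [m] against [m' + c],
   so the linear terms match. *)
have := x'm (m - c); rewrite /Upsilon -!lerBlDr -!addrA => H.
have D : \sum_(i < N) (f (l i x - G * (m' + c)) - f (l i x - G * m)) <=
         \sum_(i < N) (f (l i x' - G * m') - f (l i x' - G * (m - c))).
  apply: ler_sum => i _.
  have h0 : 0 <= G * (m - (m' + c)) by rewrite mulr_ge0 ?subr_ge0 ?ltW.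
  have ab : l i x - G * m <= l i x' - G * (m - c) by have := lc i; lra.
  have := convex_function_incr_diff
    (psi_conj_convex N_gt1 eps_gt0 psi_convex) ab h0.
  rewrite [l i x - _ + _](_ : _ = l i x - G * (m' + c)); last by ring.
  by rewrite [l i x' - _ + _](_ : _ = l i x' - G * m'); last by ring.
move: D; rewrite !big_split/= !sumrN; lra.
Qed.

Lemma ystar_dist (x x' : 'rV[R]_d) (c : R) :
  (forall i, `|l i x - l i x'| <= G * c) ->
  `|ystar eps G psi l x - ystar eps G psi l x'| <= c.
Proof.
move=> lc; rewrite ler_distlC; apply/andP; split; rewrite ?lerBlDr;
  by apply: ystar_le_shift => i; have := lc i; rewrite ler_norml; lra.
Qed.

End Upsilon.

Theorem lemma5 (R : realType) (d N : nat) (X : set 'rV[R]_d)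
    (l : 'I_N -> 'rV[R]_d -> R) (psi : R -> R) (G eps : R)
    (hN : (1 < N)%N) (hG : 0 < G) (heps : 0 < eps)
    (hpsi : convex_function (E := R^o) `[0, +oo[%classic psi) :
  [/\ forall x, X x ->
        argmin (Upsilon eps G psi l x) (ystar eps G psi l x),
      forall x x', X x -> X x' ->
        `|ystar eps G psi l x - ystar eps G psi l x'|
          <= G^-1 * `|lvec l x - lvec l x'|
    & (forall i x x', X x -> X x' -> `|l i x - l i x'| <= G * enorm (x - x')) ->
      forall x x', X x -> X x' ->
        `|ystar eps G psi l x - ystar eps G psi l x'| <= enorm (x - x')].
Proof.
split=> [x _|x x' _ _|lip x x' Xx Xx'].
- exact: (ystar_argmin l hN hG heps hpsi x).1.
- apply: ystar_dist => // i.
  rewrite mulVKf ?gt_eqF//.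
  have -> : l i x - l i x' = (lvec l x - lvec l x') 0 i by rewrite !mxE.
  (* The matrix norm is the largest absolute value of an entry, here at least that of entry [i]. *)
  rewrite [in leRHS]/Num.norm/= mx_normrE.
  exact: (le_bigmax _ (fun ij => `|(lvec l x - lvec l x') ij.1 ij.2|) (0, i)).
- by apply: ystar_dist => // i; exact: lip.
Qed.
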